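(* Let $A_1,\dots,A_m\in\mathbb{R}^{n\times n}$ and let $l\ge 1$ be an integer. For a real square matrix $A$ of size $N\times N$ let $M_A$ denote a matrix representation of the linear operator $X\mapsto AXA^T$ on the space of real symmetric $N\times N$ matrices. Then $$\frac1m\,\rho\big(M_{A_1}^{\otimes l}+\cdots+M_{A_m}^{\otimes l}\big)\;\le\;\rho(A_1,\dots,A_m)^{2l}\;\le\;\rho\big(M_{A_1}^{\otimes l}+\cdots+M_{A_m}^{\otimes l}\big)$$ and $$\frac1m\,\rho\big(M_{A_1^{\otimes l}}+\cdots+M_{A_m^{\otimes l}}\big)\;\le\;\rho(A_1,\dots,A_m)^{2l}\;\le\;\rho\big(M_{A_1^{\otimes l}}+\cdots+M_{A_m^{\otimes l}}\big).$$
   Context: For a single real square matrix $A$, $\rho(A)=\lim_{k\to\infty}\|A^k\|^{1/k}$ is the spectral radius (the largest modulus of an eigenvalue). For a finite set of real $n\times n$ matrices the joint spectral radius is $$\rho(A_1,\dots,A_m)=\limsup_{k\to+\infty}\ \max_{\sigma\in\{1,\dots,m\}^k}\|A_\sigma\|^{1/k},\qquad A_\sigma=A_{\sigma_k}\cdots A_{\sigma_2}A_{\sigma_1},$$ where $\|\cdot\|$ is any matrix norm (the value does not depend on the choice). For each matrix size $N$, all matrix representations $M_A$ are taken with respect to one and the same fixed basis of the space of real symmetric $N\times N$ matrices (of dimension $N(N+1)/2$). $A^{\otimes l}=A\otimes\cdots\otimes A$ ($l$ factors) denotes the $l$-th Kronecker power, where $A\otimes B$ is the Kronecker product (block matrix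 with blocks $A_{ij}B$). *)

(* Defs.v *)
From HB Require Import structures.
From mathcomp Require Import all_boot all_order all_algebra.
From mathcomp Require Import all_classical all_reals all_analysis.
From mathcomp Require Import mxtens.

Set Implicit Arguments.
Unset Strict Implicit.
Unset Printing Implicit Defensive.

Import Order.TTheory GRing.Theory Num.Theory.
Import numFieldNormedType.Exports.

Local Open Scope ring_scope.

(* Submultiplicativity is not required: in finite dimension the two limits
   below do not depend on the norm, submultiplicative or not. *)
Record is_norm (R : realType) (V : lmodType R) (nrm : V -> R) : Prop := IsNorm {
  is_norm_triangle : forall x y, nrm (x + y) <= nrm x + nrm y;
  is_norm_scale : forall a x, nrm (a *: x) = `|a| * nrm x;
  is_norm_eq0 : forall x, nrm x = 0 -> x = 0 }.

(* The norms nrm N on N x N matrices are a parameter; the term k = 0 of the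
   sequences below is a conventional value (0^-1 = 0, x `^ 0 = 1) and is
   irrelevant to the limits. *)
Definition spectral_radius (R : realType) (nrm : forall N, 'M[R]_N -> R)
    (N : nat) (A : 'M[R]_N) : R :=
  limn (fun k : nat => nrm N (A ^+ k) `^ (k%:R^-1)).

(* A_(s_k) * ... * A_(s_2) * A_(s_1): the first letter of s acts first. *)
Definition word_mx (R : realType) (m n : nat) (A : 'I_m -> 'M[R]_n)
    (s : seq 'I_m) : 'M[R]_n :=
  \prod_(i <- rev s) A i.

Definition joint_spectral_radius (R : realType) (nrm : forall N, 'M[R]_N -> R)
    (m n : nat) (A : 'I_m -> 'M[R]_n) : R :=
  limn_sup (fun k : nat =>
    \big[Num.max/0]_(s : k.-tuple 'I_m) (nrm n (word_mx A s) `^ (k%:R^-1))).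

Definition symmx_space (R : realType) (N : nat) : {vspace 'M[R]_N} :=
  fixedSpace (linfun (@trmx R N N)).

Lemma mem_symmx_space (R : realType) (N : nat) (X : 'M[R]_N) :
  (X \in symmx_space R N) = (X^T == X).
Proof. by apply/fixedSpaceP/eqP; rewrite lfunE. Qed.

(* Matrix, in the basis b of the space of symmetric matrices, of the operator
   X |-> A X A^T: column j holds the coordinates of the image of the j-th
   basis vector. *)
Definition congr_repr (R : realType) (N : nat)
    (b : (\dim (symmx_space R N)).-tuple 'M[R]_N) (A : 'M[R]_N) :
    'M[R]_(\dim (symmx_space R N)) :=
  \matrix_(i, j) coord b i (A *m b`_j *m A^T).

(* Main.v *)
Require Import Defs.
From HB Require Import structures.
From mathcomp Require Import all_boot all_order all_algebra.
From mathcomp Require Import all_classical all_reals all_analysis.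
From mathcomp Require Import mxtens.

Import Order.TTheory GRing.Theory Num.Theory.
Import numFieldNormedType.Exports.

Local Open Scope classical_set_scope.
Local Open Scope ring_scope.

(** Write $|A|$ for the sum of the moduli of the entries of $A$ and $p = 2l$.
    Both families of matrices in the theorem are the values $\phi(A_i)$ of one
    multiplicative map: $\phi(A) = M_A^{\otimes l}$ in the first pair of
    inequalities, $\phi(A) = M_{A^{\otimes l}}$ in the second. Both maps are
    homogeneous of degree $p$ and comparable to $|A|^p$ in the following sense:
    - $|\phi(A)| \le C_1 |A|^p$;
    - $|A|^p \le C_2 L(\phi(A))$ for a fixed linear functional $L$.
    The functional comes from applying $X \mapsto A X A^T$ to the identity and
    taking the trace, which yields $\mathrm{tr}(A A^T)$, the square of the
    Frobenius norm; in coordinates this reads $u M_A v$ for a fixed row $u$ and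
    a fixed column $v$ ([trace_congr_repr]), and it passes to Kronecker powers
    because the sum of all entries is multiplicative for them. The Frobenius norm
    is comparable to $|A|$ by the Cauchy-Schwarz inequality, and
    $|A^{\otimes l}| = |A|^l$.

    Let $B = \sum_i \phi(A_i)$. Since $\phi$ is multiplicative, $B^k$ is the sum
    of $\phi(A_\sigma)$ over the $m^k$ words $\sigma$ of length $k$
    ([exp_sum_words]). The upper bound on $\phi$ gives
    $|B^k| \le C_1 m^k \max_\sigma |A_\sigma|^p$. For the other direction all the
    numbers $L(\phi(A_\sigma))$ are nonnegative, so each of them is at most
    $L(B^k)$, whence $\max_\sigma |A_\sigma|^p \le C_2 L(B^k) \le C |B^k|$. Taking
    $k$-th roots and letting $k$ tend to infinity removes the constants
    ([joint_spectral_radius_sandwich]).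

    The limits exist by the lemma of Fekete ([fekete]), as $|B^k|$ and
    $\max_\sigma |A_\sigma|$ are submultiplicative in $k$, and they do not depend
    on the norm because all norms on a space of matrices are equivalent
    ([norm_sandwich]). *)

(** * Limits of k-th roots *)

Definition root_seq {R : realType} (u : nat -> R) (k : nat) : R :=
  u k `^ (k%:R^-1).

Lemma root_seq_ge0 {R : realType} (u : nat -> R) k : 0 <= root_seq u k.
Proof. exact: powR_ge0. Qed.

Lemma root_seqK {R : realType} (u : nat -> R) k :
  (forall j, 0 <= u j) -> (0 < k)%N -> root_seq u k ^+ k = u k.
Proof.
move=> u0 k0; rewrite -powR_mulrn ?root_seq_ge0// -powRrM mulVf ?powRr1//.
by rewrite pnatr_eq0 -lt0n.
Qed.

Lemma exp_root {R : realType} (x : R) k :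
  0 <= x -> (0 < k)%N -> (x ^+ k) `^ (k%:R^-1) = x.
Proof.
move=> x0 k0; rewrite -powR_mulrn// -powRrM mulfV ?powRr1//.
by rewrite pnatr_eq0 -lt0n.
Qed.

Lemma cvg_root_cst {R : realType} (C : R) :
  0 < C -> root_seq (fun=> C) @ \oo --> (1 : R).
Proof.
move=> C0; rewrite -cvg_shiftS /=.
(* With the term k = 0 dropped, the exponent of C is the harmonic sequence. *)
have -> : (fun k => root_seq (fun=> C) k.+1) =
          (fun k => expR (harmonic k * ln C)).
  by apply/funext => k; rewrite /root_seq /powR gt_eqF.
rewrite -(@expR0 R).
apply: continuous_cvg; first exact: continuous_expR.
by rewrite -(mul0r (ln C)); apply: cvgMl; exact: cvg_harmonic.
Qed.

Lemma root_seq_le {R : realType} (u v : nat -> R) k :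
  (forall j, 0 <= u j) -> u k <= v k -> root_seq u k <= root_seq v k.
Proof.
move=> u0 uv; apply: ge0_ler_powR => //; rewrite ?nnegrE ?invr_ge0//.
exact: le_trans uv.
Qed.

Lemma root_seq_scale {R : realType} (C : R) (u : nat -> R) k :
  0 <= C -> (forall j, 0 <= u j) ->
  root_seq (fun j => C * u j) k = root_seq (fun=> C) k * root_seq u k.
Proof. by move=> C0 u0; rewrite /root_seq powRM. Qed.

Lemma cvg_root_scale {R : realType} (C r : R) (u : nat -> R) :
  0 < C -> (forall j, 0 <= u j) -> root_seq u @ \oo --> r ->
  root_seq (fun j => C * u j) @ \oo --> r.
Proof.
move=> C0 u0 ur; rewrite -[r]mul1r.
have -> : root_seq (fun j => C * u j) =
          (fun k => root_seq (fun=> C) k * root_seq u k).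
  by apply/funext => k; rewrite root_seq_scale// ltW.
by apply: cvgM => //; exact: cvg_root_cst.
Qed.

Lemma root_lim_le {R : realType} (C a b : R) (u v : nat -> R) :
  0 < C -> (forall j, 0 <= u j) -> (forall j, 0 <= v j) ->
  (forall j, u j <= C * v j) ->
  root_seq u @ \oo --> a -> root_seq v @ \oo --> b -> a <= b.
Proof.
move=> C0 u0 v0 uv ua vb.
apply: (ler_cvg_to ua (cvg_root_scale _ _ _ C0 v0 vb)).
by near=> k; exact: root_seq_le.
Unshelve. all: by end_near. Qed.

Lemma root_seq_squeeze {R : realType} (c C r : R) (u v : nat -> R) :
  0 < c -> 0 < C -> (forall j, 0 <= u j) ->
  (forall j, c * u j <= v j <= C * u j) ->
  root_seq u @ \oo --> r -> root_seq v @ \oo --> r.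
Proof.
move=> c0 C0 u0 uv ur.
have v0 j : 0 <= v j.
  by have /andP[+ _] := uv j; apply: le_trans; rewrite mulr_ge0// ltW.
apply: (squeeze_cvgr _ (cvg_root_scale _ _ _ c0 u0 ur)
                       (cvg_root_scale _ _ _ C0 u0 ur)).
near=> k; have /andP[uvk vuk] := uv k; rewrite !root_seq_le// => j.
by rewrite mulr_ge0// ltW.
Unshelve. all: by end_near. Qed.

(** The exponential factor $b^k$ accounts for the number $m^k$ of words. *)
Lemma cvg_root_exp {R : realType} (b r : R) (p : nat) (u : nat -> R) :
  0 <= b -> (forall j, 0 <= u j) -> root_seq u @ \oo --> r ->
  root_seq (fun k => b ^+ k * u k ^+ p) @ \oo --> b * r ^+ p.
Proof.
move=> b0 u0 ur.
have : (fun k => b * root_seq u k ^+ p) @ \oo --> b * r ^+ p.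
  apply: cvgMr; apply: (@continuous_cvg _ _ _ _ _ _ (fun x : R => x ^+ p)) ur.
  exact: exprn_continuous.
(* The term k = 0 is dropped: there every root is 1, which breaks the identity
   below. *)
rewrite -cvg_shiftS /= => h; rewrite -cvg_shiftS /=.
suff -> : (fun k => root_seq (fun k => b ^+ k * u k ^+ p) k.+1) =
          (fun k => b * root_seq u k.+1 ^+ p) by [].
apply/funext => k.
rewrite {1}/root_seq powRM ?exprn_ge0// exp_root//; congr (_ * _).
by rewrite -(powR_mulrn p (u0 _)) -(powR_mulrn p (root_seq_ge0 _ _)) powRAC.
Qed.

(** Write $k = tq + s$ with $s < q$: then $u_k \le u_q^t u_s \le x^{tq} u_s$, so the
    finitely many values $u_s x^{-s}$ determine the constant. *)
Lemma submult_geometric {R : realType} (u : nat -> R) (q : nat) (x : R) :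
  (0 < q)%N -> (forall j, 0 <= u j) ->
  (forall j k, u (j + k)%N <= u j * u k) -> 0 < x -> u q <= x ^+ q ->
  exists2 K, 0 < K & forall k, u k <= K * x ^+ k.
Proof.
move=> q0 u0 uM x0 uq.
pose K := 1 + \sum_(s < q) u s / x ^+ s.
have t0 s : 0 <= u s / x ^+ s by rewrite divr_ge0// exprn_ge0// ltW.
have K0 : 0 < K by rewrite ltr_pwDl// sumr_ge0.
exists K => //; elim/ltn_ind => k IH.
have [kq|qk] := ltnP k q.
  rewrite -ler_pdivrMr ?exprn_gt0// /K (bigD1 (Ordinal kq))//= addrCA lerDl.
  by rewrite addr_ge0// sumr_ge0.
rewrite -(subnKC qk) (le_trans (uM _ _))// exprD mulrCA.
by apply: ler_pM => //; apply: IH; rewrite ltn_subrL q0 (leq_trans q0).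
Qed.

(** The limit is the infimum of the roots with $k \ge 1$: any $x$ above it exceeds
    some root of index $q$, hence $u_k \le K x^k$ for all $k$, and the constant $K$
    disappears in the limit. *)
Lemma fekete {R : realType} (u : nat -> R) :
  (forall j, 0 <= u j) -> (forall j k, u (j + k)%N <= u j * u k) ->
  cvgn (root_seq u).
Proof.
move=> u0 uM.
pose S : set R := [set root_seq u k | k in [set k | (0 < k)%N]].
have S0 : S !=set0 by exists (root_seq u 1); exists 1%N.
have Slb : has_lbound S by exists 0 => _ [k _ <-]; exact: root_seq_ge0.
have infS0 : 0 <= inf S by apply: lb_le_inf => // _ [k _ <-]; exact: root_seq_ge0.
apply/cvg_ex; exists (inf S); apply/cvgrPdist_le => e e0.
pose x := inf S + e / 2.
have e20 : 0 < e / 2 by rewrite divr_gt0.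
have x0 : 0 < x by rewrite ltr_wpDl.
have [_ [q q0 <-]] : exists2 y, S y & y < x.
  by apply: inf_adherent => //; split.
move=> /ltW qx.
have uqx : u q <= x ^+ q.
  by rewrite -(root_seqK u q)// lerXn2r ?nnegrE ?root_seq_ge0// ltW.
have [K K0 uK] := submult_geometric u q x q0 u0 uM x0 uqx.
have /cvgrPdist_le/(_ _ e20) hK : (fun k => root_seq (fun=> K) k * x) @ \oo --> x.
  by rewrite -{2}(mul1r x); apply: cvgMl; exact: cvg_root_cst.
near=> k.
have k0 : (0 < k)%N by near: k; exact: nbhs_infty_gt.
have lo : inf S <= root_seq u k by apply: ge_inf => //; exists k.
have hi : root_seq u k <= root_seq (fun=> K) k * x.
  apply: (le_trans (root_seq_le _ (fun k => K * x ^+ k) _ u0 (uK k))).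
  by rewrite /root_seq powRM ?exp_root// ltW// exprn_gt0.
have : `|x - root_seq (fun=> K) k * x| <= e / 2 by near: k.
rewrite distrC ler_norml => /andP[_]; rewrite lerBlDr => hKx.
rewrite distrC ger0_norm ?subr_ge0// lerBlDl (le_trans hi)// (le_trans hKx)//.
by rewrite /x addrCA -splitr.
Unshelve. all: by end_near. Qed.

(** * The entrywise 1-norm and Kronecker products *)

(** The reference norm: it is submultiplicative, and multiplicative for Kronecker
    products because the entries of such a product are the products of one entry
    of each factor. *)
Definition norm1 {R : realType} {p q : nat} (A : 'M[R]_(p, q)) : R :=
  \sum_i \sum_j `|A i j|.

(** A linear substitute for [norm1]: it extracts the coefficient of a 1 x 1 matrix
    and remains multiplicative for Kronecker products. *)
Definition entry_sum {R : realType} {p q : nat} (A : 'M[R]_(p, q)) : R :=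
  \sum_i \sum_j A i j.

Lemma norm1_ge0 {R : realType} {p q} (A : 'M[R]_(p, q)) : 0 <= norm1 A.
Proof. by apply: sumr_ge0 => i _; apply: sumr_ge0. Qed.

Lemma le_norm1 {R : realType} {p q} (A : 'M[R]_(p, q)) i j :
  `|A i j| <= norm1 A.
Proof.
rewrite /norm1 (bigD1 i)//= (bigD1 j)//= -addrA lerDl addr_ge0 ?sumr_ge0//.
by move=> k _; rewrite sumr_ge0.
Qed.

Lemma norm1D {R : realType} {p q} (A B : 'M[R]_(p, q)) :
  norm1 (A + B) <= norm1 A + norm1 B.
Proof.
rewrite /norm1 -big_split ler_sum//= => i _; rewrite -big_split ler_sum//= => j _.
by rewrite mxE ler_normD.
Qed.

Lemma norm1_sum {R : realType} {p q} (I : finType) (F : I -> 'M[R]_(p, q)) :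
  norm1 (\sum_i F i) <= \sum_i norm1 (F i).
Proof.
elim/big_ind2: _ => // [|x A y B xA yB].
  by rewrite /norm1 big1// => i _; rewrite big1// => j _; rewrite mxE normr0.
by rewrite (le_trans (norm1D _ _))// lerD.
Qed.

Lemma norm1M {R : realType} {p q r} (A : 'M[R]_(p, q)) (B : 'M[R]_(q, r)) :
  norm1 (A *m B) <= norm1 A * norm1 B.
Proof.
rewrite /norm1 mulr_suml ler_sum// => i _.
apply: (@le_trans _ _ (\sum_j \sum_k `|A i k| * `|B k j|)).
  apply: ler_sum => j _; rewrite mxE (le_trans (ler_norm_sum _ _ _))//.
  by apply: ler_sum => k _; rewrite normrM.
rewrite exchange_big mulr_suml ler_sum//= => k _; rewrite -mulr_sumr.
by rewrite ler_wpM2l// (bigD1 k)//= lerDl sumr_ge0// => i' _; exact: sumr_ge0.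
Qed.

Lemma norm1_tr {R : realType} {p q} (A : 'M[R]_(p, q)) : norm1 A^T = norm1 A.
Proof.
rewrite /norm1 exchange_big; apply: eq_bigr => i _; apply: eq_bigr => j _.
by rewrite mxE.
Qed.

Lemma norm_entry_sum {R : realType} {p q} (A : 'M[R]_(p, q)) :
  `|entry_sum A| <= norm1 A.
Proof.
by apply: le_trans (ler_norm_sum _ _ _) _; apply: ler_sum => i _; exact: ler_norm_sum.
Qed.

Lemma entry_sum_sum {R : realType} {p q} (I : finType) (F : I -> 'M[R]_(p, q)) :
  entry_sum (\sum_i F i) = \sum_i entry_sum (F i).
Proof.
rewrite /entry_sum [RHS]exchange_big; apply: eq_bigr => i _.
by rewrite [RHS]exchange_big; apply: eq_bigr => j _; rewrite summxE.
Qed.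

Lemma entry_sum_tens {R : realType} {p q r s}
    (A : 'M[R]_(p, q)) (B : 'M[R]_(r, s)) :
  entry_sum (A *t B) = entry_sum A * entry_sum B.
Proof.
rewrite /entry_sum mulr_sum; apply: eq_bigr => i _; rewrite mulr_sum.
by apply: eq_bigr => j _; rewrite mxE.
Qed.

Lemma norm1_entry_sum {R : realType} {p q} (A : 'M[R]_(p, q)) :
  norm1 A = entry_sum (map_mx Num.norm A).
Proof. by apply: eq_bigr => i _; apply: eq_bigr => j _; rewrite mxE. Qed.

Lemma norm1_tens {R : realType} {p q r s}
    (A : 'M[R]_(p, q)) (B : 'M[R]_(r, s)) :
  norm1 (A *t B) = norm1 A * norm1 B.
Proof.
rewrite !norm1_entry_sum -entry_sum_tens; congr entry_sum.
by apply/matrixP => i j; rewrite !mxE normrM.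
Qed.

Lemma entry_sum_ntens {R : realType} {p q} (A : 'M[R]_(p, q)) l :
  entry_sum (A ^t l) = entry_sum A ^+ l.
Proof.
case: l => [|l].
  by rewrite ntensmx0 expr0 /entry_sum !big_ord_recl !big_ord0 mxE !addr0.
by elim: l => [|l IH]; rewrite ?ntensmx1 ?expr1// ntensmxSS entry_sum_tens IH -exprS.
Qed.

Lemma norm1_ntens {R : realType} {p q} (A : 'M[R]_(p, q)) l :
  norm1 (A ^t l) = norm1 A ^+ l.
Proof.
case: l => [|l].
  by rewrite ntensmx0 expr0 /norm1 !big_ord_recl !big_ord0 mxE !addr0 normr1.
by elim: l => [|l IH]; rewrite ?ntensmx1 ?expr1// ntensmxSS norm1_tens IH -exprS.
Qed.

Lemma ntensmxM {R : realType} {p q r} (A : 'M[R]_(p, q)) (B : 'M[R]_(q, r)) l :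
  A ^t l *m B ^t l = (A *m B) ^t l.
Proof.
case: l => [|l]; first by rewrite !ntensmx0 mul1mx.
by elim: l => [|l IH]; rewrite ?ntensmx1// !ntensmxSS tensmx_mul IH.
Qed.

Lemma tens1mx1 {R : realType} p q :
  (1%:M : 'M[R]_p) *t (1%:M : 'M[R]_q) = 1%:M.
Proof.
apply/matrixP => i j; case: (mxtens_indexP i) => i1 i2.
case: (mxtens_indexP j) => j1 j2; rewrite tensmxE !mxE -natrM mulnb.
by rewrite (can_eq (@mxtens_indexK p q)) xpair_eqE.
Qed.

Lemma ntensmx_id {R : realType} p l : (1%:M : 'M[R]_p) ^t l = 1%:M.
Proof.
case: l => [|l]; first by rewrite ntensmx0.
by elim: l => [|l IH]; rewrite ?ntensmx1// ntensmxSS IH tens1mx1.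
Qed.

(** The trace is the sum of the squares of the entries, so this is the
    Cauchy-Schwarz inequality; it results from summing
    $|x| |y| \le (x^2 + y^2)/2$ over all pairs of entries. *)
Lemma norm1_sqr_le_trace {R : realType} {p q} (A : 'M[R]_(p, q)) :
  norm1 A ^+ 2 <= (p * q)%:R * \tr (A *m A^T).
Proof.
have -> : norm1 A = \sum_(ij : 'I_p * 'I_q) `|A ij.1 ij.2|.
  by rewrite /norm1 pair_big.
have -> : \tr (A *m A^T) = \sum_(ij : 'I_p * 'I_q) `|A ij.1 ij.2| ^+ 2.
  rewrite /mxtrace -(pair_big xpredT xpredT (fun i j => `|A i j| ^+ 2))/=.
  apply: eq_bigr => i _; rewrite mxE; apply: eq_bigr => j _.
  by rewrite mxE real_normK ?num_real// expr2.
rewrite expr2 mulr_suml.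
apply: (@le_trans _ _ (\sum_(x : 'I_p * 'I_q) \sum_(y : 'I_p * 'I_q)
   (`|A x.1 x.2| ^+ 2 / 2 + `|A y.1 y.2| ^+ 2 / 2))).
  apply: ler_sum => x _; rewrite mulr_sumr; apply: ler_sum => y _.
  rewrite -mulrDl ler_pdivlMr// -subr_ge0.
  rewrite (_ : _ - _ = (`|A x.1 x.2| - `|A y.1 y.2|) ^+ 2) ?sqr_ge0//.
  by rewrite sqrrB mulr_natr addrAC.
under eq_bigr do rewrite big_split/= sumr_const card_prod !card_ord.
rewrite big_split/= sumr_const card_prod !card_ord sumrMnl.
by rewrite -mulrnDl -mulr_suml -splitr mulr_natl.
Qed.

(** * Equivalence of norms on matrices *)

Lemma is_norm0 {R : realType} {V : lmodType R} (nrm : V -> R) :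
  is_norm nrm -> nrm 0 = 0.
Proof. by move=> [_ nZ _]; rewrite -(scale0r 0) nZ normr0 mul0r. Qed.

Lemma is_normN {R : realType} {V : lmodType R} (nrm : V -> R) :
  is_norm nrm -> forall x, nrm (- x) = nrm x.
Proof. by move=> [_ nZ _] x; rewrite -scaleN1r nZ normrN1 mul1r. Qed.

Lemma is_norm_ge0 {R : realType} {V : lmodType R} (nrm : V -> R) :
  is_norm nrm -> forall x, 0 <= nrm x.
Proof.
move=> h x; have := is_norm_triangle h x (- x).
by rewrite subrr is_norm0// is_normN// -mulr2n pmulrn_lge0.
Qed.

Lemma is_norm_sum {R : realType} {V : lmodType R} (nrm : V -> R) :
  is_norm nrm -> forall (I : finType) (F : I -> V),
  nrm (\sum_i F i) <= \sum_i nrm (F i).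
Proof.
move=> h I F; elim/big_ind2: _ => // [|x a y b xa yb]; first by rewrite is_norm0.
by rewrite (le_trans (is_norm_triangle h _ _))// lerD.
Qed.

(** Decompose along the elementary matrices. *)
Lemma is_norm_le_norm1 {R : realType} {p q} (nrm : 'M[R]_(p, q) -> R) :
  is_norm nrm -> exists2 C, 0 < C & forall A, nrm A <= C * norm1 A.
Proof.
move=> h; pose C := 1 + \sum_i \sum_j nrm (delta_mx i j).
have s0 i : 0 <= \sum_j nrm (delta_mx i j).
  by apply: sumr_ge0 => j _; exact: is_norm_ge0.
exists C; first by rewrite ltr_pwDl// sumr_ge0.
move=> A; rewrite {1}[A]matrix_sum_delta (le_trans (is_norm_sum _ h _ _))//.
rewrite /norm1 mulr_sumr ler_sum// => i _.
rewrite (le_trans (is_norm_sum _ h _ _))// mulr_sumr ler_sum// => j _.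
rewrite (is_norm_scale h) mulrC ler_wpM2r// /C (bigD1 i)//= (bigD1 j)//=.
rewrite addrCA -addrA lerDl !addr_ge0//.
  by rewrite sumr_ge0// => *; exact: is_norm_ge0.
by rewrite sumr_ge0.
Qed.

Lemma le_mx_norm {R : realType} {p q} (A : 'M[R]_(p, q)) i j : `|A i j| <= `|A|.
Proof.
by rewrite [leRHS]/Num.norm /= mx_normrE; apply/bigmax_geP; right; exists (i, j).
Qed.

Lemma norm1_le_entries {R : realType} {p q} (A : 'M[R]_(p, q)) (M : R) :
  (forall i j, `|A i j| <= M) -> norm1 A <= (p * q)%:R * M.
Proof.
move=> AM; apply: (@le_trans _ _ (\sum_(i < p) \sum_(j < q) M)).
  by apply: ler_sum => i _; apply: ler_sum => j _.
by rewrite !sumr_const !card_ord -mulrnA mulnC mulr_natl.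
Qed.

Lemma norm1_le_mx_norm {R : realType} {p q} (A : 'M[R]_(p, q)) :
  norm1 A <= (p * q)%:R * `|A|.
Proof. by apply: norm1_le_entries => i j; exact: le_mx_norm. Qed.

Lemma is_norm_continuous {R : realType} {p q} (nrm : 'M[R]_(p, q) -> R) :
  is_norm nrm -> continuous nrm.
Proof.
move=> h x; have [C C0 nC] := is_norm_le_norm1 nrm h.
have dist y : `|nrm x - nrm y| <= C * (1 + (p * q)%:R) * `|x - y|.
  have nB a c : nrm a - nrm c <= nrm (a - c).
    by rewrite lerBlDr (le_trans _ (is_norm_triangle h _ _))// subrK.
  rewrite (@le_trans _ _ (nrm (x - y)))//.
    by rewrite ler_norml nB lerNl opprB -(is_normN _ h (x - y)) opprB nB.
  rewrite (le_trans (nC _))// -mulrA ler_pM2l// (le_trans (norm1_le_mx_norm _))//.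
  by rewrite ler_wpM2r// lerDr.
apply/(@cvgrPdist_le _ _ _ (nbhs x) (nbhs_filter x)) => e e0.
have K0 : 0 < C * (1 + (p * q)%:R) by rewrite mulr_gt0// ltr_pwDl.
have r0 : 0 < (C * (1 + (p * q)%:R))^-1 * e by rewrite mulr_gt0// invr_gt0.
apply: filterS (nbhsx_ballx x _ r0) => y; rewrite -ball_normE /= => xy.
by rewrite (le_trans (dist y))// -ler_pdivlMl// ltW.
Qed.

(** The unit sphere of the sup norm is compact and the norm is continuous and
    nonzero on it, so it has a positive minimum there; homogeneity does the
    rest. *)
Lemma mx_norm_le_is_norm {R : realType} {d} (nrm : 'rV[R]_d -> R) :
  is_norm nrm -> exists2 C, 0 < C & forall v, `|v| <= C * nrm v.
Proof.
move=> h; pose S : set 'rV[R]_d := [set v | `|v| = 1].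
have norm_unit v : v != 0 -> S (`|v|^-1 *: v).
  by move=> v0; rewrite /S/= normrZ normfV normr_id mulVf ?normr_eq0.
have [S0|S0] := pselect (S !=set0); last first.
  (* The sphere is empty only if every vector is zero. *)
  exists 1 => // v; have [->|v0] := eqVneq v 0.
    by rewrite normr0 mul1r is_norm_ge0.
  by exfalso; apply: S0; exists (`|v|^-1 *: v); exact: norm_unit.
have Scompact : compact S.
  apply: bounded_closed_compact.
    exists 1; split; first exact: num_real.
    by move=> x x1 v /= ->; exact: ltW.
  have -> : S = (fun v : 'rV[R]_d => `|v|) @^-1` [set 1] by [].
  apply: closed_comp; last exact: closed_eq.
  by move=> v _; exact: norm_continuous.
have nrm_cont : {within S, continuous nrm}.
  by apply: continuous_subspaceT; exact: is_norm_continuous.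
have [c /set_mem cS cmin] := EVT_min_rV S0 Scompact nrm_cont.
have c0 : 0 < nrm c.
  rewrite lt_neqAle is_norm_ge0// andbT eq_sym; apply/eqP => /(is_norm_eq0 h) c0.
  by move/eqP: cS; rewrite c0 normr0 eq_sym oner_eq0.
exists (nrm c)^-1; first by rewrite invr_gt0.
move=> v; have [->|v0] := eqVneq v 0.
  by rewrite normr0 mulr_ge0 ?(is_norm_ge0 _ h)// invr_ge0 ltW.
have := cmin _ (mem_set (norm_unit v v0)).
rewrite (is_norm_scale h) normfV normr_id ler_pdivlMl ?normr_gt0//.
by rewrite ler_pdivlMl// mulrC.
Qed.

Lemma norm1_le_is_norm {R : realType} {p q} (nrm : 'M[R]_(p, q) -> R) :
  is_norm nrm -> exists2 C, 0 < C & forall A, norm1 A <= C * nrm A.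
Proof.
move=> h; have hv : is_norm (nrm \o vec_mx).
  split=> [x y|a x|x /=]; first by rewrite /= linearD is_norm_triangle.
    by rewrite /= linearZ is_norm_scale.
  by move/(is_norm_eq0 h)/eqP; rewrite vec_mx_eq0 => /eqP.
have [C C0 nC] := mx_norm_le_is_norm _ hv.
exists ((1 + (p * q)%:R) * C); first by rewrite mulr_gt0 ?ltr_pwDl.
move=> A; have := nC (mxvec A); rewrite /= mxvecK => AC.
rewrite -mulrA (@le_trans _ _ ((p * q)%:R * (C * nrm A)))//; last first.
  by rewrite ler_wpM2r ?lerDr// mulr_ge0 ?is_norm_ge0// ltW.
apply: norm1_le_entries => i j.
by rewrite -mxvecE (le_trans (le_mx_norm _ _ _)).
Qed.

Lemma norm_sandwich {R : realType} {N} (nrm : 'M[R]_N -> R) : is_norm nrm ->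
  exists c C, [/\ 0 < c, 0 < C & forall A, c * norm1 A <= nrm A <= C * norm1 A].
Proof.
move=> h; have [C C0 nC] := is_norm_le_norm1 _ h.
have [D D0 nD] := norm1_le_is_norm _ h.
exists D^-1, C; split; rewrite ?invr_gt0// => A.
by rewrite nC andbT ler_pdivrMl.
Qed.

(** * Products along words and spectral radii *)

Lemma word_mx_cons {R : realType} {m n} (A : 'I_m -> 'M[R]_n) i s :
  word_mx A (i :: s) = word_mx A s *m A i.
Proof. by rewrite /word_mx rev_cons -cats1 big_cat big_seq1. Qed.

Lemma word_mx_cat {R : realType} {m n} (A : 'I_m -> 'M[R]_n) s t :
  word_mx A (s ++ t) = word_mx A t *m word_mx A s.
Proof. by rewrite /word_mx rev_cat big_cat. Qed.

Lemma word_mx_morph {R : realType} {m n d} (phi : 'M[R]_n -> 'M[R]_d)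
    (A : 'I_m -> 'M[R]_n) s :
  phi 1%:M = 1%:M -> (forall X Y, phi (X *m Y) = phi X *m phi Y) ->
  word_mx (fun i => phi (A i)) s = phi (word_mx A s).
Proof.
move=> phi1 phiM; elim: s => [|i s IH]; first by rewrite /word_mx !big_nil phi1.
by rewrite !word_mx_cons IH phiM.
Qed.

(** The noncommutative expansion of a power of a sum; the last factor of the
    power is the first letter of the word. *)
Lemma exp_sum_words {R : realType} {m n} (A : 'I_m -> 'M[R]_n) k :
  (\sum_i A i) ^+ k = \sum_(s : k.-tuple 'I_m) word_mx A s.
Proof.
elim: k => [|k IH].
  rewrite expr0 (bigD1 [tuple])//= big1 ?addr0 => [|s]; last by case/eqP; exact: tuple0.
  by rewrite /word_mx big_nil.
rewrite exprSr IH mulr_suml.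
under eq_bigr do rewrite mulr_sumr.
rewrite (reindex (fun p : k.-tuple 'I_m * 'I_m => cons_tuple p.2 p.1))/=.
  by rewrite pair_big; apply: eq_bigr => -[s i] _; rewrite word_mx_cons.
exists (fun s => (behead_tuple s, thead s)) => [[s i] _|s _].
  by rewrite theadE; congr (_, _); apply: val_inj.
by rewrite [s in RHS]tuple_eta; apply: val_inj.
Qed.

Definition max_word {R : realType} {m n} (f : 'M[R]_n -> R)
    (A : 'I_m -> 'M[R]_n) (k : nat) : R :=
  \big[Num.max/0]_(s : k.-tuple 'I_m) f (word_mx A s).

Lemma max_word_ge0 {R : realType} {m n} (f : 'M[R]_n -> R)
  (A : 'I_m -> 'M[R]_n) k : 0 <= max_word f A k.
Proof. exact: bigmax_ge_id. Qed.

Lemma le_max_word {R : realType} {m n} (f : 'M[R]_n -> R)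
  (A : 'I_m -> 'M[R]_n) k (s : k.-tuple 'I_m) :
  f (word_mx A s) <= max_word f A k.
Proof. exact: le_bigmax. Qed.

Lemma max_word_attained {R : realType} {m n} (f : 'M[R]_n -> R)
    (A : 'I_m -> 'M[R]_n) k : (0 < m)%N -> (forall X, 0 <= f X) ->
  exists s : k.-tuple 'I_m, max_word f A k = f (word_mx A s).
Proof.
move=> m0 f0; have s0 : k.-tuple 'I_m := nseq_tuple k (Ordinal m0).
by eexists; apply: (bigmax_eq_arg _ s0).
Qed.

(** Cut a word of length $j + k$ after its first $j$ letters. *)
Lemma max_word_submult {R : realType} {m n} (A : 'I_m -> 'M[R]_n) j k :
  max_word norm1 A (j + k)%N <= max_word norm1 A j * max_word norm1 A k.
Proof.
apply: bigmax_le => [|s _]; first by rewrite mulr_ge0// max_word_ge0.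
have sE : val s = take j s ++ drop j s by rewrite cat_take_drop.
have tj : size (take j s) == j by rewrite size_takel ?size_tuple// leq_addr.
have dk : size (drop j s) == k by rewrite size_drop size_tuple addKn.
rewrite sE word_mx_cat mulrC (le_trans (norm1M _ _))//.
apply: ler_pM; rewrite ?norm1_ge0//.
  exact: (le_max_word norm1 A k (Tuple dk)).
exact: (le_max_word norm1 A j (Tuple tj)).
Qed.

(** Roots are nondecreasing on nonnegative numbers, so they commute with the
    maximum; since $k > 0$, they also fix its default value 0. *)
Lemma max_word_root {R : realType} {m n} (f : 'M[R]_n -> R)
    (A : 'I_m -> 'M[R]_n) k : (forall X, 0 <= f X) -> (0 < k)%N ->
  \big[Num.max/0]_(s : k.-tuple 'I_m) (f (word_mx A s) `^ (k%:R^-1)) =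
  root_seq (max_word f A) k.
Proof.
move=> f0 k0; rewrite /root_seq /max_word.
have ki : 0 <= (k%:R^-1 : R) by rewrite invr_ge0.
suff [] : 0 <= max_word f A k /\
  \big[Num.max/0]_(s : k.-tuple 'I_m) (f (word_mx A s) `^ (k%:R^-1)) =
  max_word f A k `^ (k%:R^-1) by [].
rewrite /max_word.
elim/big_ind2: _ => [|x1 x2 y1 y2 [x0 xE] [y0 yE]|s _]; last by split.
  by split=> //; rewrite powR0// invr_eq0 pnatr_eq0 -lt0n.
split; first by rewrite le_max x0.
rewrite {x1}xE {y1}yE; case: (leP x2 y2) => [|/ltW] xy.
  by rewrite max_r// ge0_ler_powR.
by rewrite max_l// ge0_ler_powR.
Qed.

Lemma cvg_max_word {R : realType} {m n} (A : 'I_m -> 'M[R]_n) :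
  cvgn (root_seq (max_word norm1 A)).
Proof.
by apply: fekete => [j|j k]; [exact: max_word_ge0|exact: max_word_submult].
Qed.

(** The upper limit that defines the joint spectral radius is a limit, for any
    norm and in particular for [norm1]. *)
Lemma cvg_joint_spectral_radius {R : realType}
    (nrm : forall N, 'M[R]_N -> R) {m n} (A : 'I_m -> 'M[R]_n) :
  (forall N, is_norm (nrm N)) ->
  root_seq (max_word norm1 A) @ \oo --> joint_spectral_radius nrm A.
Proof.
move=> h; have [c [C [c0 C0 nc]]] := norm_sandwich _ (h n).
have /cvg_ex[r ur] := cvg_max_word A.
suff -> : joint_spectral_radius nrm A = r by [].
have vr : root_seq (max_word (nrm n) A) @ \oo --> r.
  apply: (root_seq_squeeze c C r (max_word norm1 A)) => // [j|j].
    exact: max_word_ge0.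
  apply/andP; split.
    rewrite -ler_pdivlMl//; apply: bigmax_le => [|s _].
      by rewrite mulr_ge0 ?max_word_ge0// invr_ge0 ltW.
    rewrite ler_pdivlMl//; have /andP[+ _] := nc (word_mx A s).
    by move/le_trans; apply; exact: le_max_word.
  apply: bigmax_le => [|s _]; first by rewrite mulr_ge0 ?max_word_ge0// ltW.
  have /andP[_ /le_trans] := nc (word_mx A s); apply.
  by rewrite ler_pM2l//; exact: le_max_word.
apply: (cvg_limn_inf_sup _).2; rewrite -cvg_shiftS/=; rewrite -cvg_shiftS/= in vr.
suff -> : (fun k : nat => \big[Num.max/0]_(s : k.+1.-tuple 'I_m)
             (nrm n (word_mx A s) `^ (k.+1%:R^-1))) =
          (fun k => root_seq (max_word (nrm n) A) k.+1) by [].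
by apply/funext => k; rewrite max_word_root//; exact: is_norm_ge0.
Qed.

Lemma cvg_spectral_radius {R : realType}
    (nrm : forall N, 'M[R]_N -> R) {n} (B : 'M[R]_n) :
  (forall N, is_norm (nrm N)) ->
  root_seq (fun k => norm1 (B ^+ k)) @ \oo --> spectral_radius nrm B.
Proof.
move=> h; have [c [C [c0 C0 nc]]] := norm_sandwich _ (h n).
have /cvg_ex[r ur] : cvgn (root_seq (fun k => norm1 (B ^+ k))).
  by apply: fekete => [j|j k]; rewrite ?norm1_ge0// exprD norm1M.
suff -> : spectral_radius nrm B = r by [].
apply/cvg_lim => //.
by apply: (root_seq_squeeze c C r _ (fun k => nrm n (B ^+ k)) c0 C0) ur => [j|j];
  [exact: norm1_ge0|exact: nc].
Qed.

(** The core of the argument, for a multiplicative map $\phi$ comparable to the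
    $p$-th power of the norm: from above in norm, and from below through the
    linear functional $X \mapsto S(U X V)$, where $S$ is the sum of the entries.
    The terms of the expansion of a power of the sum of the $\phi(A_i)$ have
    nonnegative images under this functional, so that no cancellation can make
    the power small. *)
Lemma joint_spectral_radius_sandwich {R : realType}
    (nrm : forall N, 'M[R]_N -> R) {m n d a c p} (phi : 'M[R]_n -> 'M[R]_d)
    (U : 'M[R]_(a, d)) (V : 'M[R]_(d, c)) (C1 C2 : R) (A : 'I_m -> 'M[R]_n) :
  (forall N, is_norm (nrm N)) -> (0 < m)%N ->
  phi 1%:M = 1%:M -> (forall X Y, phi (X *m Y) = phi X *m phi Y) ->
  0 < C1 -> (forall X, norm1 (phi X) <= C1 * norm1 X ^+ p) ->
  0 < C2 -> (forall X, norm1 X ^+ p <= C2 * entry_sum (U *m phi X *m V)) ->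
  m%:R^-1 * spectral_radius nrm (\sum_i phi (A i))
      <= joint_spectral_radius nrm A ^+ p /\
  joint_spectral_radius nrm A ^+ p <= spectral_radius nrm (\sum_i phi (A i)).
Proof.
move=> h m0 phi1 phiM C10 phiC1 C20 phiC2.
have rho := cvg_spectral_radius nrm (\sum_i phi (A i)) h.
have jsr := cvg_joint_spectral_radius nrm A h.
have powE k : (\sum_i phi (A i)) ^+ k =
    \sum_(s : k.-tuple 'I_m) phi (word_mx A s).
  by rewrite exp_sum_words; apply: eq_bigr => s _; rewrite word_mx_morph.
have w0 := max_word_ge0 norm1 A.
have b0 k : 0 <= norm1 ((\sum_i phi (A i)) ^+ k) := norm1_ge0 _.
split.
  rewrite ler_pdivrMl ?ltr0n//.
  apply: (root_lim_le C1 _ _ _ (fun k => m%:R ^+ k * max_word norm1 A k ^+ p)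
            C10 b0 _ _ rho) => [k|k|].
  - by rewrite mulr_ge0 ?exprn_ge0.
  - rewrite powE (le_trans (norm1_sum _ _))//.
    apply: (@le_trans _ _ (\sum_(s : k.-tuple 'I_m) C1 * max_word norm1 A k ^+ p)).
      apply: ler_sum => s _; rewrite (le_trans (phiC1 _))// ler_pM2l//.
      by rewrite lerXn2r ?nnegrE ?norm1_ge0//; exact: le_max_word.
    by rewrite sumr_const card_tuple card_ord mulrCA -natrX mulr_natl.
  - exact: cvg_root_exp.
pose K := C2 * (1 + norm1 U * norm1 V).
have K0 : 0 < K by rewrite mulr_gt0// ltr_pwDl// mulr_ge0// norm1_ge0.
rewrite -[X in X <= _]mul1r.
apply: (root_lim_le K _ _ (fun k => 1 ^+ k * max_word norm1 A k ^+ p) _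
          K0 _ b0 _ _ rho) => [k|k|].
- by rewrite mulr_ge0 ?exprn_ge0.
- have S0 X : 0 <= entry_sum (U *m phi X *m V).
    by rewrite -(pmulr_rge0 _ C20) (le_trans _ (phiC2 X))// exprn_ge0// norm1_ge0.
  rewrite expr1n mul1r.
  have SB : entry_sum (U *m (\sum_i phi (A i)) ^+ k *m V)
      <= (1 + norm1 U * norm1 V) * norm1 ((\sum_i phi (A i)) ^+ k).
    rewrite (le_trans (ler_norm _))// (le_trans (norm_entry_sum _))//.
    rewrite (le_trans (norm1M _ _))// mulrDl mul1r mulrAC ler_wpDl//.
    by rewrite ler_wpM2r ?norm1_ge0// norm1M.
  rewrite -mulrA (le_trans _ (ler_wpM2l (ltW C20) SB))//.
  rewrite powE mulmx_sumr mulmx_suml entry_sum_sum.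
  (* The functional of the whole sum dominates its term at a maximizing word. *)
  have [s ->] := max_word_attained norm1 A k m0 norm1_ge0.
  rewrite (le_trans (phiC2 _))// ler_pM2l// (bigD1 s)//= lerDl.
  by apply: sumr_ge0 => s' _; exact: S0.
- exact: cvg_root_exp.
Qed.

(** * The representation on symmetric matrices *)

Lemma congr_symm {R : realType} {N} (A X : 'M[R]_N) :
  X \in symmx_space R N -> A *m X *m A^T \in symmx_space R N.
Proof.
by rewrite !mem_symmx_space => /eqP XT; rewrite !trmx_mul trmxK XT mulmxA.
Qed.

Lemma basis_symm {R : realType} {N} (b : (\dim (symmx_space R N)).-tuple 'M[R]_N) :
  basis_of (symmx_space R N) b -> forall j : 'I_(\dim (symmx_space R N)),
  b`_j \in symmx_space R N.
Proof. by move=> hb j; apply: (basis_mem hb); rewrite mem_nth// size_tuple. Qed.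

Lemma congr_repr_id {R : realType} {N}
    (b : (\dim (symmx_space R N)).-tuple 'M[R]_N) :
  basis_of (symmx_space R N) b -> congr_repr b 1%:M = 1%:M.
Proof.
move=> hb; apply/matrixP => i j; rewrite !mxE mul1mx trmx1 mulmx1.
by rewrite coord_free ?(basis_free hb)// eq_sym.
Qed.

Lemma congr_coord {R : realType} {N}
    (b : (\dim (symmx_space R N)).-tuple 'M[R]_N) (A X : 'M[R]_N) i :
  basis_of (symmx_space R N) b -> X \in symmx_space R N ->
  coord b i (A *m X *m A^T) = \sum_j congr_repr b A i j * coord b j X.
Proof.
move=> hb XS; rewrite {1}(coord_basis hb XS) mulmx_sumr mulmx_suml linear_sum.
apply: eq_bigr => j _.
by rewrite -scalemxAr -scalemxAl linearZ mxE mulrC.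
Qed.

Lemma congr_reprM {R : realType} {N}
    (b : (\dim (symmx_space R N)).-tuple 'M[R]_N) (A B : 'M[R]_N) :
  basis_of (symmx_space R N) b ->
  congr_repr b (A *m B) = congr_repr b A *m congr_repr b B.
Proof.
move=> hb; apply/matrixP => i j; rewrite [LHS]mxE [RHS]mxE.
have BS := congr_symm B _ (basis_symm b hb j).
rewrite (_ : _ *m _ *m _ = A *m (B *m b`_j *m B^T) *m A^T); last first.
  by rewrite trmx_mul !mulmxA.
rewrite congr_coord//; apply: eq_bigr => k _.
by rewrite [congr_repr b B k j]mxE.
Qed.

Lemma linear_le_norm1 {R : realType} {p q} (f : {scalar 'M[R]_(p, q)}) :
  exists2 C, 0 < C & forall X, `|f X| <= C * norm1 X.
Proof.
pose C := 1 + norm1 (\matrix_(i, j) f (delta_mx i j)).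
have C0 : 0 < C by rewrite ltr_pwDl// norm1_ge0.
exists C => // X.
rewrite {1}[X]matrix_sum_delta linear_sum (le_trans (ler_norm_sum _ _ _))//.
rewrite /norm1 mulr_sumr ler_sum// => i _.
rewrite linear_sum (le_trans (ler_norm_sum _ _ _))// mulr_sumr ler_sum// => j _.
rewrite linearZ normrM mulrC ler_wpM2r//.
have := le_norm1 (\matrix_(i, j) f (delta_mx i j)) i j.
by rewrite mxE => /le_trans; apply; rewrite lerDr.
Qed.

(** The entries of [congr_repr b A] are fixed linear functionals of the matrices
    $A b_j A^T$, which are quadratic in $A$. *)
Lemma norm1_congr_repr {R : realType} {N}
    (b : (\dim (symmx_space R N)).-tuple 'M[R]_N) :
  exists2 C, 0 < C & forall A, norm1 (congr_repr b A) <= C * norm1 A ^+ 2.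
Proof.
have /choice[c hc] i : exists C, 0 < C /\
    forall X, `|coord b i X| <= C * norm1 X.
  by have [C C0 hC] := linear_le_norm1 (coord b i); exists C.
have c0 i : 0 <= c i by have [/ltW] := hc i.
pose C := 1 + \sum_i \sum_(j < \dim (symmx_space R N)) c i * norm1 b`_j.
exists C.
  rewrite ltr_pwDl// sumr_ge0// => i _; rewrite sumr_ge0// => j _.
  by rewrite mulr_ge0// norm1_ge0.
move=> A; rewrite (@le_trans _ _ ((\sum_i \sum_(j < \dim (symmx_space R N))
    c i * norm1 b`_j) * norm1 A ^+ 2))//.
  rewrite mulr_suml ler_sum// => i _; rewrite mulr_suml ler_sum// => j _.
  rewrite mxE; have [_ /(_ _)/le_trans] := hc i; apply.
  rewrite -mulrA ler_wpM2l// (le_trans (norm1M _ _))// norm1_tr expr2 mulrA.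
  by rewrite ler_wpM2r ?norm1_ge0// mulrC norm1M.
by rewrite ler_wpM2r ?exprn_ge0 ?norm1_ge0// lerDr.
Qed.

Definition trace_row {R : realType} {N}
    (b : (\dim (symmx_space R N)).-tuple 'M[R]_N) :
    'rV[R]_(\dim (symmx_space R N)) := \row_i \tr b`_i.

Definition id_coords {R : realType} {N}
    (b : (\dim (symmx_space R N)).-tuple 'M[R]_N) :
    'cV[R]_(\dim (symmx_space R N)) := \col_i coord b i 1%:M.

(** The column vector represents the identity matrix and the row vector the
    trace, so the product is the trace of the image of the identity under
    $X \mapsto A X A^T$. *)
Lemma trace_congr_repr {R : realType} {N}
    (b : (\dim (symmx_space R N)).-tuple 'M[R]_N) (A : 'M[R]_N) :
  basis_of (symmx_space R N) b ->
  entry_sum (trace_row b *m congr_repr b A *m id_coords b) = \tr (A *m A^T).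
Proof.
move=> hb; have idS : 1%:M \in symmx_space R N by rewrite mem_symmx_space trmx1.
rewrite /entry_sum !big_ord_recl !big_ord0 !addr0 -mulmxA mxE.
have AS := congr_symm A _ idS; rewrite mulmx1 in AS.
rewrite [in RHS](coord_basis hb AS) linear_sum; apply: eq_bigr => i _.
rewrite linearZ mxE mulrC; congr (_ * _).
rewrite -{2}[A]mulmx1 congr_coord// mxE.
by apply: eq_bigr => j _; rewrite [id_coords _ _ _]mxE.
Qed.

Theorem mainTheorem6 (R : realType)
    (nrm : forall N : nat, 'M[R]_N -> R)
    (hnrm : forall N : nat, is_norm (nrm N))
    (b : forall N : nat, (\dim (symmx_space R N)).-tuple 'M[R]_N)
    (hb : forall N : nat, basis_of (symmx_space R N) (b N))
    (m n l : nat) (hm : (0 < m)%N) (hn : (0 < n)%N) (hl : (0 < l)%N)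
    (A : 'I_m -> 'M[R]_n) :
  let rho_tens := spectral_radius nrm (\sum_(i < m) (congr_repr (b n) (A i)) ^t l) in
  let rho_repr := spectral_radius nrm (\sum_(i < m) congr_repr (b (n ^ l)%N) ((A i) ^t l)) in
  (m%:R^-1 * rho_tens <= joint_spectral_radius nrm A ^+ (2 * l) /\
   joint_spectral_radius nrm A ^+ (2 * l) <= rho_tens) /\
  (m%:R^-1 * rho_repr <= joint_spectral_radius nrm A ^+ (2 * l) /\
   joint_spectral_radius nrm A ^+ (2 * l) <= rho_repr).
Proof.
have [C1 C10 hC1] := norm1_congr_repr (b n).
have [C2 C20 hC2] := norm1_congr_repr (b (n ^ l)%N).
split.
(* The last constant in both cases comes from the Cauchy-Schwarz inequality: it is
   the number of entries of the matrix (to the power l in the first case). *)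
- apply: (joint_spectral_radius_sandwich nrm (fun X => congr_repr (b n) X ^t l)
    (trace_row (b n) ^t l) (id_coords (b n) ^t l)
    (C1 ^+ l) ((n * n)%:R ^+ l)) => //.
  + by rewrite congr_repr_id// ntensmx_id.
  + by move=> X Y; rewrite congr_reprM// ntensmxM.
  + exact: exprn_gt0.
  + move=> X; rewrite norm1_ntens exprM -exprMn lerXn2r ?nnegrE ?norm1_ge0//.
    by rewrite mulr_ge0 ?exprn_ge0 ?norm1_ge0// ltW.
  + by rewrite exprn_gt0// ltr0n muln_gt0 hn.
  + move=> X; rewrite !ntensmxM entry_sum_ntens trace_congr_repr// exprM -exprMn.
    rewrite lerXn2r ?nnegrE ?exprn_ge0 ?norm1_ge0//; last exact: norm1_sqr_le_trace.
    by rewrite (le_trans _ (norm1_sqr_le_trace X))// exprn_ge0// norm1_ge0.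
- apply: (joint_spectral_radius_sandwich nrm
    (fun X => congr_repr (b (n ^ l)%N) (X ^t l))
    (trace_row (b (n ^ l)%N)) (id_coords (b (n ^ l)%N))
    C2 (n ^ l * n ^ l)%:R) => //.
  + by rewrite ntensmx_id congr_repr_id.
  + by move=> X Y; rewrite -ntensmxM congr_reprM.
  + by move=> X; rewrite mulnC exprM -norm1_ntens.
  + by rewrite ltr0n muln_gt0 expn_gt0 hn.
  + by move=> X; rewrite trace_congr_repr// mulnC exprM -norm1_ntens norm1_sqr_le_trace.
Qed.
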